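(* Let $G$ be a finite group and let $r$ be the integer with $i(G)=c(G)-r$. Then: (1) $r=0$ if and only if $G\cong \mathbb{Z}_2^n$ for some integer $n\ge 0$. (2) $r=1$ if and only if $G$ is isomorphic to $\mathbb{Z}_4$, or to $D_8$, or to $\mathbb{Z}_p$ or $D_{2p}$ for some odd prime $p$. (3) $r=2$ if and only if $G$ is isomorphic to one of $\mathbb{Z}_2\times\mathbb{Z}_4$, $\mathbb{Z}_2\times D_8$, $\mathbb{Z}_8$, $D_{16}$, or to one of $\mathbb{Z}_{p^2}$, $D_{2p^2}$, $\mathbb{Z}_{2p}$, $D_{4p}$ for some odd prime $p$.
   Context: For a finite group $G$ with identity $e$, $C(G)$ is the set of all cyclic subgroups of $G$ (including the trivial subgroup), $c(G)=|C(G)|$, and $i(G)=|\{x\in G: x^2=e\}|$ (so the identity is counted). $\mathbb{Z}_n$ is the cyclic group of order $n$, and $D_{2n}$ is the dihedral group of order $2n$. *)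

(* Defs.v *)
From mathcomp Require Import all_boot all_algebra all_fingroup all_solvable.

Set Implicit Arguments.
Unset Strict Implicit.
Unset Printing Implicit Defensive.

Local Open Scope group_scope.

Section CyclicSubgroups.

Variables (gT : finGroupType) (G : {group gT}).

Definition cyclic_subgroups : {set {group gT}} :=
  [set H : {group gT} | (H \subset G) && cyclic H].

Definition num_cyclic : nat := #|cyclic_subgroups|.

(* The identity is counted. *)
Definition num_invol : nat := #|[set x in G | x ^+ 2 == 1]|.

End CyclicSubgroups.

(* Main.v *)
(* The difference r = c(G) - i(G) counts the cyclic subgroups of G of order > 2
   ("long" cyclic subgroups), because cyclic subgroups of order at most 2
   correspond to solutions of x^2 = 1.  If all of them lie in a subgroup P, then
   every element outside P is an involution, hence inverts P; when P contains an
   element of order > 2, a product of two such elements lies in P, so G = P or G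
   is a generalized dihedral group over P.
   If r = 1, or if r = 2 and one long cyclic subgroup contains the other, P can be
   taken cyclic, and counting the divisors of |P| that exceed 2 gives its order.
   If r = 2 and neither <a> nor <b> contains the other, they normalize each
   other, and ab must be an involution since it cannot generate a third long
   cyclic subgroup; this forces both orders to be 4, a^2 = b^2 and ab = ba, so
   that P = <a> x <ab> is Z_4 x Z_2. *)

Require Import Defs.
From mathcomp Require Import all_boot all_algebra all_fingroup all_solvable.
From mathcomp Require Import zify.

Local Open Scope group_scope.

(** * Cyclic subgroups of order greater than 2 and how to count them *)

Definition long_cyclic {gT : finGroupType} (G : {set gT}) : {set {group gT}} :=
  [set H : {group gT} | [&& H \subset G, cyclic H & 2 < #|H|]].

Lemma order_gt2 (gT : finGroupType) (x : gT) : (2 < #[x]) = (x ^+ 2 != 1).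
Proof.
rewrite -order_dvdn; have := order_gt0 x.
by case: #[x] => [|[|[|n]]] // _; rewrite gtnNdvd.
Qed.

Lemma cycle_long (gT : finGroupType) (G : {group gT}) (x : gT) :
  (<[x]>%G \in long_cyclic G) = (x \in G) && (x ^+ 2 != 1).
Proof. by rewrite inE cycle_cyclic cycle_subG -order_gt2. Qed.

Lemma long_cyclicP {gT : finGroupType} {G : {group gT}} {H : {group gT}} :
  reflect (exists2 x, (x \in G) && (x ^+ 2 != 1) & H = <[x]>%G)
          (H \in long_cyclic G).
Proof.
apply: (iffP idP) => [|[x Gx ->]]; last by rewrite cycle_long.
move=> HG; have:= HG; rewrite inE => /and3P[_ /cyclicP[x defH] _].
have eqH : H = <[x]>%G by apply: val_inj.
by exists x => //; rewrite -cycle_long -eqH.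
Qed.

Lemma num_cyclicE (gT : finGroupType) (G : {group gT}) :
  num_cyclic G = (num_invol G + #|long_cyclic G|)%N.
Proof.
rewrite /num_cyclic -(cardsID (long_cyclic G)) addnC; congr (_ + _)%N; last first.
  by apply: eq_card => H; rewrite !inE; case: (H \subset G); case: (cyclic H).
(* A group of order at most 2 has only one generator, so [x] can be recovered from [<[x]>]. *)
have injc : {in [set x in G | x ^+ 2 == 1] &, injective (fun x : gT => <[x]>%G)}.
  move=> x y; rewrite !inE => /andP[_ x2] /andP[_ y2] /(congr1 val)/= eqxy.
  have: x \in <[y]> by rewrite -eqxy cycle_id.
  rewrite -order_dvdn dvdn_divisors // !inE in y2; case/pred2P: y2 => oy.
    move/eqP: eqxy; move/eqP: oy; rewrite order_eq1 => /eqP->.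
    by rewrite cycle1 cycle_eq1 => /eqP->.
  rewrite cycle2g // !inE => /pred2P[x1|//].
  by move: oy; rewrite orderE -eqxy x1 cycle1 cards1.
rewrite /num_invol -(card_in_imset injc); apply: eq_card => H.
apply/setDP/imsetP => [[]|[x]].
  rewrite !inE => /andP[sHG cH]; rewrite sHG cH /=.
  case/cyclicP: cH => x defH; rewrite defH order_gt2 negbK => x2.
  by exists x; [rewrite inE x2 -cycle_subG -defH sHG | apply: val_inj].
rewrite inE => /andP[Gx x2] ->; rewrite cycle_long x2 andbF.
by rewrite inE cycle_subG Gx cycle_cyclic.
Qed.

Lemma isog_card_long_cyclic (aT rT : finGroupType)
    (G : {group aT}) (H : {group rT}) :
  G \isog H -> #|long_cyclic G| = #|long_cyclic H|.
Proof.
have leq_long (aT1 rT1 : finGroupType) (G1 : {group aT1}) (H1 : {group rT1}) :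
    G1 \isog H1 -> #|long_cyclic G1| <= #|long_cyclic H1|.
  case/isogP => f injf defH.
  have injF : {in long_cyclic G1 &, injective (fun K : {group aT1} => (f @* K)%G)}.
    move=> A B; rewrite !inE => /andP[sA _] /andP[sB _] /(congr1 val) /= eqf.
    by apply: val_inj; apply: (injm_morphim_inj injf).
  rewrite -(card_in_imset injF); apply: subset_leq_card; apply/subsetP => K.
  case/imsetP=> A; rewrite inE => /and3P[sA cA lA] ->.
  by rewrite inE /= card_injm // lA morphim_cyclic // -defH morphimS.
move=> isoGH; apply/eqP; rewrite eqn_leq !leq_long //.
by rewrite isog_sym.
Qed.

(** A cyclic group has exactly one subgroup of each order dividing its own, so taking orders matches
    long cyclic subgroups with divisors greater than 2. *)
Lemma card_long_cyclic (gT : finGroupType) (G : {group gT}) :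
  cyclic G -> #|long_cyclic G| = count (ltn 2) (divisors #|G|).
Proof.
move=> cG; rewrite -size_filter.
have inj : {in long_cyclic G &, injective (fun H : {group gT} => #|H|)}.
  move=> A B; rewrite !inE => /andP[sA _] /andP[sB _] eqAB.
  by apply/val_inj/eqP; rewrite /= (eq_subG_cyclic cG) // eqAB.
rewrite cardE -(size_map (fun H : {group gT} => #|H|)).
apply/perm_size/uniq_perm.
- rewrite map_inj_in_uniq ?enum_uniq // => A B; rewrite !mem_enum; exact: inj.
- by rewrite filter_uniq ?divisors_uniq.
move=> d; rewrite mem_filter -dvdn_divisors ?cardG_gt0 //.
apply/mapP/andP => [[H]|[d2 dG]].
  by rewrite mem_enum inE => /and3P[sH _ lH] ->; rewrite cardSg.
case/cyclicP: (cG) => x defG; rewrite defG -orderE in dG.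
have := cycle_sub_group dG => /setP/(_ <[x ^+ (#[x] %/ d)]>%G).
rewrite !inE eqxx /= => /andP[sH /eqP oH].
by exists <[x ^+ (#[x] %/ d)]>%G; rewrite ?mem_enum ?inE /= ?defG ?sH ?cycle_cyclic ?oH.
Qed.

(** A generator of a long cyclic subgroup does not square to 1, so it already lies in [P]. This
    moves the count from [G] to a subgroup that is better understood. *)
Lemma long_cyclic_sub (gT : finGroupType) (P G : {group gT}) :
  P \subset G -> {in G, forall x, x \notin P -> x ^+ 2 = 1} ->
  long_cyclic P = long_cyclic G.
Proof.
move=> sPG outP; apply/setP=> H; apply/long_cyclicP/long_cyclicP => -[x].
  by case/andP => Px x2 ->; exists x; rewrite ?(subsetP sPG) ?x2.
case/andP => Gx x2 ->; exists x; rewrite // x2 andbT.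
by apply: contraR x2 => P'x; rewrite outP.
Qed.

Lemma long_cyclic_out (gT : finGroupType) (P G : {group gT}) :
  (forall H : {group gT}, H \in long_cyclic G -> H \subset P) ->
  {in G, forall x, x \notin P -> x ^+ 2 = 1}.
Proof.
move=> sP x Gx P'x; apply/eqP; apply: contraR P'x => x2.
by rewrite -cycle_subG; apply: (sP <[x]>%G); rewrite cycle_long Gx.
Qed.

(** * Integers with one or two divisors greater than 2 *)

Lemma count_divisors1P n : 0 < n ->
  count (ltn 2) (divisors n) = 1%N <-> n = 4 \/ (prime n /\ odd n).
Proof.
move=> n0; split; last first.
  case=> [->|[pn on]] //.
  have /seq.permP-> : perm_eq (divisors n) [:: 1; n]%N.
    apply: uniq_perm; rewrite ?divisors_uniq //= ?inE ?andbT.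
      by rewrite neq_ltn prime_gt1.
    move=> d; rewrite -dvdn_divisors // !inE; apply/idP/pred2P; last by case=> ->.
    by move/(prime_nt_dvdP pn) => h; case: (eqVneq d 1%N) => [|/h]; [left|right].
  by rewrite /= odd_prime_gt2.
rewrite -size_filter; set s := filter _ _ => s1.
have: 0 < size s by rewrite s1.
case defs: s s1 => [|d [|]] // _ _.
have D e : e %| n -> 2 < e -> e = d.
  move=> en e2; have: e \in s by rewrite mem_filter /= e2 -dvdn_divisors.
  by rewrite defs inE => /eqP.
have: d \in s by rewrite defs inE.
rewrite mem_filter -dvdn_divisors // => /andP[/= d2 dn].
have nd : n = d by apply: D => //; apply: leq_trans d2 (dvdn_leq n0 dn).
subst d.
(* The only divisor above 2 is now [n] itself. An odd prime dividing [n] therefore equals [n];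
   without one, [n] is a power of 2 above 2, so 4 divides it and equals it. *)
have [[p [pp op pn]]|no] : (exists p, [/\ prime p, odd p & p %| n]) \/ 2.-nat n.
- case: (boolP (2.-nat n)) => [|]; first by right.
  rewrite /pnat n0 /= => /allPn[p]; rewrite mem_primes !inE => /and3P[pp _ pn] p2.
  by left; exists p; split=> //; case: (even_prime pp) p2 => [->|].
- have pE: p = n by apply: D => //; apply: odd_prime_gt2.
  by right; rewrite -pE.
case/p_natP: no => k nk; left; case: k nk => [|[|k]] nk; rewrite ?nk // in d2 *.
by rewrite -nk; symmetry; apply: D => //; rewrite nk !expnS mulnA dvdn_mulr.
Qed.

Lemma count_divisors2P n : 0 < n ->
  count (ltn 2) (divisors n) = 2%N <->
  n = 8 \/ exists p, [/\ prime p, odd p & n = (p ^ 2)%N \/ n = (2 * p)%N].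
Proof.
move=> n0; split; last first.
  case=> [->|[p [pp op nE]]] //; have p2 := odd_prime_gt2 op pp.
  case: nE => nE.
    have /seq.permP-> : perm_eq (divisors n) [:: 1; p; p ^ 2]%N.
      apply: uniq_perm; rewrite ?divisors_uniq //= ?inE ?andbT ?negb_or.
        by rewrite -mulnn; nia.
      move=> d; rewrite -dvdn_divisors // !inE nE.
      apply/(dvdn_pfactor _ _ pp)/or3P => [[[|[|[|m]]] //= _ ->]|].
      - by rewrite expn0; constructor 1.
      - by rewrite expn1; constructor 2.
      - by constructor 3.
      by case=> /eqP->; [exists 0%N|exists 1%N|exists 2%N].
    rewrite /= p2; have -> // : 2 < p ^ 2.
    by apply: leq_trans p2 _; rewrite -{1}(expn1 p) leq_exp2l // prime_gt1.
  have /seq.permP-> : perm_eq (divisors n) [:: 1; 2; p; 2 * p]%N.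
    apply: uniq_perm; rewrite ?divisors_uniq //= ?inE ?andbT ?negb_or.
      by lia.
    move=> d; rewrite -dvdn_divisors // !inE nE.
    apply/idP/or4P => [dn|].
      case: (boolP (p %| d)) => [/dvdnP[k dE]|pd].
        move: dn; rewrite dE dvdn_pmul2r ?prime_gt0 // dvdn_divisors // !inE.
        by case/pred2P=> ->; rewrite ?mul1n; [constructor 3|constructor 4].
      have: d %| 2 by rewrite -(@Gauss_dvdl d 2 p) // coprime_sym prime_coprime.
      rewrite dvdn_divisors // !inE => /pred2P[] ->; [constructor 1|constructor 2]; done.
    by case=> /eqP->; [rewrite dvd1n|rewrite dvdn_mulr|rewrite dvdn_mull|].
  by rewrite /= p2 (leq_trans p2) // leq_pmull.
rewrite -size_filter; set s := filter _ _ => s2.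
have us: uniq s by rewrite filter_uniq ?divisors_uniq.
have sE e : (e \in s) = (2 < e) && (e %| n) by rewrite mem_filter -dvdn_divisors.
have ns: n \in s.
  rewrite sE dvdnn andbT; case defs: s s2 => [|d t] //= _.
  have: d \in s by rewrite defs inE eqxx.
  by rewrite sE => /andP[d2 /(dvdn_leq n0)]; apply: leq_trans.
have [d ds dn] : exists2 d, d \in s & d != n.
  case defs: s s2 us ns => [|a [|b [|]]] // _.
  rewrite /= !inE !andbT => ab /pred2P[] ->; [exists b|exists a]; rewrite ?inE ?eqxx ?orbT //.
  by rewrite eq_sym.
(* Since [s] has size 2, the distinct members [d] and [n] exhaust it. *)
have D e : e %| n -> 2 < e -> e = d \/ e = n.
  move=> en e2; have: e \in s by rewrite sE e2.
  have /perm_mem-> : perm_eq s [:: d; n].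
    rewrite perm_sym; apply: uniq_perm => //; first by rewrite /= inE dn.
    apply: (uniq_min_size _ _ _).2; rewrite ?s2 //; first by rewrite /= inE dn.
    by move=> x; rewrite !inE => /pred2P[] ->.
  by rewrite !inE => /pred2P.
move: ns ds; rewrite !sE => /andP[n2 _] /andP[d2 ddn].
have dp : d < n by rewrite ltn_neqAle dn dvdn_leq.
(* If an odd prime [p] divides [n], then [p] is the proper divisor [d], and the cofactor of [p] is
   either 2 or again [d]. Otherwise [n] is a power of 2: the value 4 would force [d] to be 3, and
   beyond it both 4 and 8 divide [n], which leaves only 8. *)
have [[p [pp op pn]]|no] : (exists p, [/\ prime p, odd p & p %| n]) \/ 2.-nat n.
- case: (boolP (2.-nat n)) => [|]; first by right.
  rewrite /pnat n0 /= => /allPn[p]; rewrite mem_primes !inE => /and3P[pp _ pn] p2.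
  by left; exists p; split=> //; case: (even_prime pp) p2 => [->|].
- right; exists p; split=> //; have p2 := odd_prime_gt2 op pp.
  have pd : p = d.
    case: (D p pn p2) => // pE; rewrite -pE in ddn.
    by apply/esym/(prime_nt_dvdP pp); rewrite // neq_ltn (ltn_trans _ d2) ?orbT.
  case/dvdnP: pn => m nE; have mn: m %| n by rewrite nE dvdn_mulr.
  case: (leqP m 2) => m2.
    case: m nE mn m2 => [|[|[|]]] // nE _ _; [by rewrite nE in n0| |by right].
    by rewrite nE mul1n pd ltnn in dp.
  case: (D m mn m2) => mE; first by left; rewrite nE mE pd -mulnn.
  by move/eqP: nE; rewrite mE eq_sym -{2}(muln1 n) eqn_pmul2l // => /eqP p1; rewrite p1 in p2.
case/p_natP: no => k nk; left; case: k nk => [|[|[|[|k]]]] nk; rewrite ?nk // in n2 dp *.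
  have d3 : d = 3 by apply/eqP; rewrite eqn_leq d2 -ltnS dp.
  by rewrite d3 nk in ddn.
have n4 : 4 %| n by rewrite nk !expnS !mulnA dvdn_mulr.
have n8 : 8 %| n by rewrite nk !expnS !mulnA dvdn_mulr.
have [d4|h] := D 4 n4 isT; last by rewrite -h in n8.
by case: (D 8 n8 isT) => e; [rewrite -d4 in e | rewrite -nk -e].
Qed.

(** * Recognising cyclic and dihedral groups *)

Lemma cyclic_isog_Zp (gT : finGroupType) (G : {group gT}) (n : nat) :
  1 < n -> G \isog [set: 'Z_n] <-> cyclic G /\ #|G| = n.
Proof.
move=> n1; have cZ : cyclic [set: 'Z_n] by rewrite Zp_cycle cycle_cyclic.
have oZ : #|[set: 'Z_n]| = n by rewrite cardsT card_ord Zp_cast.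
rewrite isog_sym (isog_cyclic_card G cZ) oZ.
by split=> [/andP[cG /eqP oG] | [-> ->]]; rewrite ?eqxx.
Qed.

(** The relations make [G] a quotient of the dihedral group by its presentation. Since [t] lies
    outside [<[x]>], the index of [<[x]>] is at least 2, so [G] is too large to be a proper
    quotient. *)
Lemma isog_dihedral (gT : finGroupType) (G : {group gT}) (x t : gT) :
    1 < #[x] -> t ^+ 2 = 1 -> t \notin <[x]> -> x ^ t = x^-1 ->
  G :=: <[x]> <*> <[t]> -> G \isog [set: 'D_(2 * #[x])].
Proof.
move=> x1 t2 P't xt defG; rewrite isogEcard mul2n card_dihedral // Grp_dihedral //.
apply/andP; split.
  by apply/existsP; exists (x, t); rewrite /= !xpair_eqE expg_order t2 xt defG !eqxx.
have sPG : <[x]> \subset G by rewrite defG joing_subl.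
rewrite -(Lagrange sPG) -muln2 leq_mul2l indexg_gt1 orbC.
apply/orP; left; apply: contra P't => /subsetP; apply.
by rewrite defG mem_gen // inE cycle_id orbT.
Qed.

(** Reflections square to 1, so every long cyclic subgroup consists of rotations and the count is
    that of the cyclic rotation group. *)
Lemma card_long_cyclic_dihedral (n : nat) : 1 < n ->
  #|long_cyclic [set: 'D_(2 * n)]| = count (ltn 2) (divisors n).
Proof.
move=> n1; have oD : #|[set: 'D_(2 * n)]| = (2 * n)%N by rewrite mul2n card_dihedral.
have: [set: 'D_(2 * n)] \homg [set: 'D_n.*2] by rewrite mul2n homg_refl.
rewrite Grp_dihedral // => /existsP[[x t]] /=.
rewrite !xpair_eqE => /and4P[/eqP defD /eqP xn /eqP t2 /eqP xt].
have nxt : <[t]> \subset 'N(<[x]>) by rewrite norms_cycle xt groupV cycle_id.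
(* The presentation only bounds the order of [x] by [n]. Equality comes from counting: [<[x]> *
   <[t]>] has [2 * n] elements and [<[t]>] has at most 2. *)
rewrite /= norm_joinEr // in defD.
have ox : #[x] = n.
  apply/eqP; rewrite eqn_leq dvdn_leq ?order_dvdn ?xn //=; last exact: ltnW.
  have := mul_cardG <[x]> <[t]>; rewrite defD oD -!orderE => e.
  have ot : #[t] <= 2 by rewrite dvdn_leq // order_dvdn t2.
  have c1 := cardG_gt0 (<[x]> :&: <[t]>).
  rewrite -(leq_pmul2l (isT : 0 < 2)) (leq_trans (leq_pmulr _ c1)) // -e.
  by rewrite mulnC leq_mul2r ot orbT.
rewrite -(long_cyclic_sub _ <[x]>%G [set: 'D_(2 * n)]%G) ?subsetT //.
  by rewrite card_long_cyclic ?cycle_cyclic // -orderE ox.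
move=> g _; have : g \in <[x]> * <[t]> by rewrite defD inE.
case/mulsgP=> y _ yx /cycleP[k ->] -> P'.
(* An even [k] would put the element inside [<[x]>], so it is a genuine reflection [x ^+ j * t]. *)
have tE : t ^+ k = t.
  rewrite -(odd_double_half k) expgD -mul2n expgM t2 expg1n mulg1.
  case: (odd k) (odd_double_half k) => // kE; case/negP: P'.
  by rewrite -kE expgD -mul2n expgM t2 expg1n !mulg1.
rewrite tE; case/cycleP: yx => j ->; rewrite expgS expg1.
have -> : x ^+ j * t * (x ^+ j * t) = x ^+ j * (t ^+ 2 * (x ^+ j) ^ t).
  by rewrite conjgE expgS expg1 -!mulgA mulKVg.
by rewrite conjXg xt t2 mul1g expgVn mulgV.
Qed.

(** * Inversion by involutions outside a subgroup *)

Lemma invol_conj (gT : finGroupType) (x t : gT) :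
  t ^+ 2 = 1 -> (t * x) ^+ 2 = 1 -> x ^ t = x^-1.
Proof.
have invE (y : gT) : y ^+ 2 = 1 -> y^-1 = y by move=> y2; apply/eqP; rewrite eq_invg_mul -y2.
by move=> t2 tx2; rewrite conjgE (invE t t2) mulgA -(invE _ tx2) invMg mulgKV.
Qed.

Section InvolutionsOutside.

Variables (gT : finGroupType) (G P : {group gT}).
Hypothesis (sPG : P \subset G).
Hypothesis (outP : {in G, forall x, x \notin P -> x ^+ 2 = 1}).

(** Both [t] and [t * x] lie outside [P], so both square to 1. *)
Lemma out_invert (t x : gT) : t \in G -> t \notin P -> x \in P -> x ^ t = x^-1.
Proof.
move=> Gt P't Px; apply: invol_conj; first exact: outP.
by apply: outP; rewrite groupMr //; apply: (subsetP sPG).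
Qed.

(** If [u * t] were outside [P] it would invert [x]; but [u] and [t] each invert [x], so their
    product fixes it, forcing [x ^+ 2 = 1]. Thus [P] has index at most 2. *)
Lemma out_mul (x t u : gT) : x \in P -> x ^+ 2 != 1 ->
  t \in G -> t \notin P -> u \in G -> u \notin P -> u * t \in P.
Proof.
move=> Px x2 Gt P't Gu P'u; apply: contraR x2 => P'ut.
have := out_invert (u * t) x (groupM Gu Gt) P'ut Px.
rewrite conjgM (out_invert u) // conjVg (out_invert t) // invgK => /eqP.
by rewrite eq_sym eq_invg_mul.
Qed.

Lemma out_gen (x t : gT) : x \in P -> x ^+ 2 != 1 ->
  t \in G -> t \notin P -> G :=: P <*> <[t]>.
Proof.
move=> Px x2 Gt P't; apply/eqP; rewrite eqEsubset join_subG sPG cycle_subG Gt !andbT.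
apply/subsetP=> u Gu; case: (boolP (u \in P)) => [|P'u].
  by move=> Pu; rewrite mem_gen // inE Pu.
have PQt : t \in P <*> <[t]> by rewrite mem_gen // inE cycle_id orbT.
by rewrite -(groupMr u PQt) mem_gen // inE (out_mul x).
Qed.

End InvolutionsOutside.

Lemma cyclic_or_dihedral (gT : finGroupType) (G : {group gT}) (x : gT) :
    x \in G -> x ^+ 2 != 1 -> {in G, forall y, y \notin <[x]> -> y ^+ 2 = 1} ->
  G \isog [set: 'Z_(#[x])] \/ G \isog [set: 'D_(2 * #[x])].
Proof.
move=> Gx x2 outP; have sPG : <[x]> \subset G by rewrite cycle_subG.
have x1 : 1 < #[x] by apply: ltnW; rewrite order_gt2.
case: (boolP (G \subset <[x]>)) => [sG|/subsetPn[t Gt P't]].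
  have defG : G :=: <[x]> by apply/eqP; rewrite eqEsubset sG.
  by left; apply/cyclic_isog_Zp; rewrite // defG cycle_cyclic.
right; apply: (isog_dihedral _ _ x t) => //; first exact: outP.
  by apply: (out_invert _ G <[x]>%G); rewrite ?cycle_id.
by apply: (out_gen _ G <[x]>%G sPG outP x); rewrite ?cycle_id.
Qed.

(** * Long cyclic subgroups of a product with Z_2 *)

Lemma long_cyclic_setX (gT : finGroupType) (H : {group gT}) (a : gT) :
    #[a] = 4 -> long_cyclic H = [set <[a]>%G] ->
  #|long_cyclic (setX [set: 'Z_2] H)| = 2.
Proof.
move=> oa longH.
have Ha : a \in H.
  by have: <[a]>%G \in long_cyclic H by [rewrite longH set11]; rewrite cycle_long => /andP[].
have a2 : a ^+ 2 != 1 by rewrite -order_gt2 oa.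
pose v (i : 'Z_2) : 'Z_2 * gT := (i, a).
have i2 (i : 'Z_2) : i * i = 1 by apply/val_inj; case: i => [[|[|]]].
(* Squares have trivial first coordinate, so whether [(i, h)] generates a long cyclic subgroup
   depends on [h] alone. *)
have gE (g : 'Z_2 * gT) : g ^+ 2 = (1, g.2 ^+ 2).
  by case: g => i h; rewrite -(i2 i).
have u1 : (Zp1 : 'Z_2) != 1 by [].
have neq : <[v Zp1]>%G != <[v 1%g]>%G.
  apply/negP => /eqP/(congr1 val)/= e.
  have: v Zp1 \in <[v 1%g]> by rewrite -e cycle_id.
  (* Powers of [v 1] keep a trivial first coordinate, which [v Zp1] does not have. *)
  case/cycleP => k /(congr1 fst) /=.
  have -> : ((v 1%g) ^+ k).1 = 1; last by move/eqP: u1.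
  by elim: k => // k IH; rewrite expgS /= IH.
suff -> : long_cyclic (setX [set: 'Z_2] H) = [set <[v Zp1]>%G; <[v 1%g]>%G].
  by rewrite cards2 neq.
apply/setP=> K; rewrite in_set2; apply/long_cyclicP/pred2P; last first.
  by case=> ->; [exists (v Zp1)|exists (v 1%g)]; rewrite // gE inE /= inE Ha /=;
     apply: contra a2 => /eqP[->].
case=> [[i h]]; rewrite gE inE /= => /andP[/andP[_ Hh] h2] ->.
have {}h2 : h ^+ 2 != 1 by apply: contra h2 => /eqP->.
have /set1P/(congr1 val)/= hE : <[h]>%G \in [set <[a]>%G] by rewrite -longH cycle_long Hh.
have : h \in <[a]> by rewrite -hE cycle_id.
case/cyclePmin => m; rewrite oa => m4 hm.
have vE : <[(i, h)]>%G = <[v i]>%G.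
  (* The exponents 0 and 2 give [h ^+ 2 = 1]. For exponent 3, [h] is the inverse of [a], so [(i, h)]
     is the inverse of [v i] and generates the same subgroup. *)
  apply: val_inj => /=; case: m m4 hm => [|[|[|[|]]]] // _ hm.
  - by rewrite hm expg1n eqxx in h2.
  - by rewrite hm.
  - by rewrite hm -expgM (_ : (2 * 2)%N = #[a]) ?expg_order ?eqxx in h2.
  rewrite -[in RHS]cycleV; congr <[_]>.
  have iV : i^-1 = i by apply/eqP; rewrite eq_invg_mul i2.
  rewrite hm /v; congr (_, _); first by rewrite iV.
  by apply/esym/eqP; rewrite eq_invg_mul -expgS -oa expg_order.
rewrite vE; case: (eqVneq i 1) => [->|i1]; [by right|left].
by congr (cycle_group (v _)); apply/val_inj; case: i i1 {vE} => [[|[|]]].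
Qed.

(** * Two long cyclic subgroups, neither containing the other *)

Lemma two_long_norm (gT : finGroupType) (G A B : {group gT}) :
  long_cyclic G = [set A; B] -> A != B -> B \subset 'N(A).
Proof.
move=> longG neqAB.
have [AG BG] : A \in long_cyclic G /\ B \in long_cyclic G by rewrite longG set21 set22.
have conjG (H : {group gT}) x : x \in G -> H \in long_cyclic G -> (H :^ x)%G \in long_cyclic G.
  by move=> Gx; rewrite !inE /= cyclicJ cardJg -{2}(conjGid Gx) conjSg.
apply/normsP=> x Bx; have Gx : x \in G.
  (* Conjugation by an element of [B] permutes the pair [A], [B] and fixes [B], hence also fixes
     [A]. *)
  by move: BG; rewrite inE => /and3P[/subsetP/(_ x Bx)].
have := conjG A x Gx AG; rewrite longG => /set2P[/(congr1 val)//|/(congr1 val)/= AxB].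
by case/eqP: neqAB; apply/val_inj; rewrite /= -(conjsgK x A) AxB conjGid ?groupV.
Qed.

Lemma two_long_structure (gT : finGroupType) (G A B : {group gT}) :
    long_cyclic G = [set A; B] -> ~~ (A \subset B) -> ~~ (B \subset A) ->
  exists a s, [/\ #[a] = 4, s ^+ 2 = 1, s \notin <[a]>, commute a s &
    <[a]> <*> <[s]> \subset G /\
    {in G, forall x, x \notin <[a]> <*> <[s]> -> x ^+ 2 = 1}].
Proof.
move=> longG nAB nBA.
have neqAB : A != B by apply: contra nAB => /eqP->.
have nBNA := two_long_norm _ _ _ _ longG neqAB.
have nANB : A \subset 'N(B).
  by apply: (two_long_norm _ G); rewrite 1?eq_sym // longG setUC.
have [AG BG] : A \in long_cyclic G /\ B \in long_cyclic G by rewrite longG set21 set22.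
(* Since [D] is not inside [C], the only long cyclic subgroup of [C] is [C] itself, and the divisor
   count applies to its order. *)
have cardAB (C D : {group gT}) : long_cyclic G = [set C; D] -> ~~ (D \subset C) ->
    #|C| = 4 \/ prime #|C|.
  move=> longG' nDC; have: C \in long_cyclic G by rewrite longG' set21.
  rewrite inE => /and3P[sC cC lC].
  suff longC : long_cyclic C = [set C].
    have := card_long_cyclic _ _ cC; rewrite longC cards1 => /esym.
    by case/(count_divisors1P _ (cardG_gt0 C)) => [|[]]; [left | right].
  apply/setP=> H; rewrite in_set1; apply/idP/eqP => [HC|->]; last by rewrite inE subxx cC.
  have: H \in long_cyclic G.
    by move: HC; rewrite !inE => /and3P[sH -> ->]; rewrite (subset_trans sH).
  rewrite longG' => /set2P[//|HD]; case/negP: nDC; rewrite -HD.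
  by move: HC; rewrite inE => /and3P[].
have cA := cardAB _ _ longG nBA.
have cB : #|B| = 4 \/ prime #|B| by apply: (cardAB B A) => //; rewrite longG setUC.
have [a /andP[Ga a2] defA] := long_cyclicP AG.
have [b /andP[Gb b2] defB] := long_cyclicP BG.
have Aa : a \in A by rewrite defA cycle_id.
have Bb : b \in B by rewrite defB cycle_id.
have B'a : a \notin B by apply: contra nAB => ?; rewrite {1}defA cycle_subG.
have A'b : b \notin A by apply: contra nBA => ?; rewrite {1}defB cycle_subG.
have Rab : [~ a, b] \in A :&: B.
  apply: (subsetP (commg_subI _ _)) (mem_commg Aa Bb); rewrite subsetI ?subxx //.
(* Otherwise [a * b] would generate a third cyclic subgroup of order > 2. *)
have ab2 : (a * b) ^+ 2 = 1.
  apply/eqP; apply: contraT => ab2.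
  have: <[a * b]>%G \in long_cyclic G by rewrite cycle_long groupM.
  rewrite longG => /set2P[] /(congr1 val)/= e; have := cycle_id (a * b); rewrite e.
    by rewrite groupMl // => Ab; rewrite Ab in A'b.
  by rewrite groupMr // => Ba; rewrite Ba in B'a.
have sq_mul : commute a b -> a ^+ 2 = (b ^+ 2)^-1.
  by move=> cab; apply/eqP; rewrite eq_sym eq_invg_mul -expgMn // -cab ab2.
(* With trivial intersection the commutator vanishes, so [(a * b) ^+ 2 = 1] puts [a ^+ 2] into both
   subgroups, making it trivial. *)
have ntI : A :&: B != 1.
  apply: contra a2 => /eqP I1; have cab : commute a b.
    by apply/commgP; move: Rab; rewrite I1 => /set1P->.
  have : a ^+ 2 \in A :&: B by rewrite inE groupX //= sq_mul // groupV groupX.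
  by rewrite I1 => /set1P->.
(* A subgroup of prime order meeting [D] nontrivially would be contained in [D]. *)
have card4 (C D : {group gT}) : C :&: D != 1 -> ~~ (C \subset D) ->
    #|C| = 4 \/ prime #|C| -> #|C| = 4.
  by move=> nt nCD [//|pC]; case/eqP: nt; apply: prime_TIg.
have oA := card4 _ _ ntI nAB cA.
have oB : #|B| = 4 by apply: (card4 B A); rewrite // setIC.
have oI : #|A :&: B| = 2.
  have I4 : #|A :&: B| %| 4 by rewrite -oA cardSg ?subsetIl.
  have I'4 : #|A :&: B| != 4.
    rewrite -oA; apply: contra nAB => /eqP e; apply/setIidPl/eqP.
    by rewrite eqEcard subsetIl e leqnn.
  have I'1 : #|A :&: B| != 1%N by rewrite -trivg_card1.
  by move: I4; rewrite dvdn_divisors // !inE (negPf I'4) (negPf I'1) orbF => /eqP.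
(* The intersection is the unique subgroup of order 2 of a cyclic group of order 4, generated by the
   square of a generator. *)
have sq_gen (c : gT) (C : {group gT}) : C = <[c]>%G -> #|C| = 4 -> A :&: B \subset C ->
    A :&: B = [set 1; c ^+ 2].
  move=> defC oC sIC; have oc : #[c] = 4 by rewrite orderE -oC defC.
  have oc2 : #[c ^+ 2] = 2 by rewrite orderXdiv oc.
  rewrite -cycle2g //; apply/eqP.
  have cC : cyclic C by rewrite defC cycle_cyclic.
  rewrite (eq_subG_cyclic cC sIC) ?cycle_subG ?groupX ?defC ?cycle_id //=.
  by rewrite oI -orderE oc2.
have IA := sq_gen a A defA oA (subsetIl _ _).
have IB := sq_gen b B defB oB (subsetIr _ _).
have a2b2 : a ^+ 2 = b ^+ 2.
  have : a ^+ 2 \in [set 1; b ^+ 2] by rewrite -IB IA set22.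
  by case/set2P => // a21; rewrite a21 eqxx in a2.
have oa : #[a] = 4 by rewrite orderE -oA defA.
have cab : commute a b.
  (* Substituting [b ^+ 2 = a ^+ 2] turns [(a * b) ^+ 2 = 1] into [a ^+ 3 * a ^ b = 1]; as
     [a ^+ 4 = 1], conjugation by [b] fixes [a]. *)
  have abE : (a * b) ^+ 2 = a * (b ^+ 2 * a ^ b).
    by rewrite conjgE expgS expg1 -[b ^+ 2]/(b * b) -!mulgA mulKVg.
  apply/commgP/conjg_fixP/(mulgI (a ^+ 2))/(mulgI a).
  by rewrite {1}a2b2 -abE ab2 mulgA -expgS -expgSr -[4]oa expg_order.
(* The involution [a * b] is preferred to [b]: with [a] it generates the same subgroup, but it
   splits off as a direct factor. *)
exists a, (a * b); rewrite -[<[a]>]/(val <[a]>%G) -defA groupMl //; split=> //.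
  by apply: commuteM => //.
have PA : A \subset <[a]> <*> <[a * b]> by rewrite {1}defA joing_subl.
have PB : B \subset <[a]> <*> <[a * b]>.
  have : a^-1 * (a * b) \in <[a]> <*> <[a * b]>.
    by rewrite groupM ?groupV ?mem_gen // inE cycle_id ?orbT.
  by rewrite mulKg {1}defB cycle_subG.
split; first by rewrite defA join_subG !cycle_subG Ga groupM.
apply: (long_cyclic_out _ (A <*> <[a * b]>)) => H.
by rewrite longG {2}defA => /set2P[] ->.
Qed.

Lemma isog_setX_Z2 (gT rT : finGroupType) (G H : {group gT}) (K : {group rT}) (s : gT) :
    s ^+ 2 = 1 -> s \notin H -> H \subset 'C[s] -> G :=: <[s]> * H -> H \isog K ->
  G \isog setX [set: 'Z_2] K.
Proof.
move=> s2 H's cHs defG isoHK.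
have os : #[s] = 2.
  by apply/(prime_nt_dvdP (isT : prime 2)); rewrite ?order_dvdn ?s2 // order_eq1;
     apply: contra H's => /eqP->.
have dG : <[s]> \x H = G.
  by rewrite defG dprodE ?cent_cycle // prime_TIg -?orderE ?os // cycle_subG.
apply: (isog_dprod dG (setX_dprod [set: 'Z_2]%G K)).
  apply: isog_trans (isog_setX1 _ _); apply/cyclic_isog_Zp => //.
  by rewrite cycle_cyclic -orderE.
by apply: isog_trans (isog_set1X _ _).
Qed.

(** An element [t] outside the subgroup generated by [a] and [s] inverts all of it, so it inverts
    [a] and commutes with [s]. Then [a] and [t] generate a dihedral group of order 8, to which [s]
    adds a direct factor of order 2. *)
Lemma isog_Z2xZ4_or_Z2xD8 (gT : finGroupType) (G : {group gT}) (a s : gT) :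
    #[a] = 4 -> s ^+ 2 = 1 -> s \notin <[a]> -> commute a s ->
    <[a]> <*> <[s]> \subset G ->
    {in G, forall x, x \notin <[a]> <*> <[s]> -> x ^+ 2 = 1} ->
  G \isog setX [set: 'Z_2] [set: 'Z_4] \/ G \isog setX [set: 'Z_2] 'D_8.
Proof.
move=> oa s2 A's cas sPG outP.
have a2 : a ^+ 2 != 1 by rewrite -order_gt2 oa.
have cAs : <[a]> \subset 'C[s] by rewrite cycle_subG; apply/cent1P.
have cAS : <[s]> \subset 'C(<[a]>) by rewrite centsC cent_cycle.
set P := (<[a]> <*> <[s]>)%G in sPG outP *.
have [Pa Ps] : a \in P /\ s \in P by rewrite !mem_gen // inE cycle_id ?orbT.
have defP : P :=: <[s]> * <[a]> by rewrite /= cent_joinEr // centC.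
case: (boolP (G \subset P)) => [sGP|/subsetPn[t Gt P't]].
  left; apply: (isog_setX_Z2 _ _ _ <[a]>%G _ s) => //.
    by rewrite -defP; apply/eqP; rewrite eqEsubset sGP.
  by apply/cyclic_isog_Zp; rewrite // cycle_cyclic -orderE.
right; have inv := out_invert _ G P sPG outP t _ Gt P't.
have t2 : t ^+ 2 = 1 by apply: outP.
have A't : t \notin <[a]>.
  by apply: contra P't; apply/subsetP/joing_subl.
pose H := (<[a]> <*> <[t]>)%G.
have nAt : <[t]> \subset 'N(<[a]>) by rewrite norms_cycle inv // groupV cycle_id.
have st : s ^ t = s by rewrite inv //; apply/eqP; rewrite eq_invg_mul; apply/eqP.
(* Writing [s] as a power of [a] times some [y] in [<[t]>] puts [y] in [P]; since [t] is not in [P],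
   [y] is 1 and [s] would lie in [<[a]>]. *)
have H's : s \notin H.
  rewrite /= norm_joinEr //; apply/negP => /mulsgP[x y Ax ty sE].
  have Px : x \in P by apply: (subsetP (joing_subl _ _)) Ax.
  have tP : y \in P by rewrite -(mulKg x y) -sE groupM ?groupV.
  have/cycle2g ct : #[t] = 2.
    by apply/(prime_nt_dvdP (isT : prime 2)); rewrite ?order_dvdn ?t2 // order_eq1;
       apply: contra A't => /eqP->.
  move: ty tP sE; rewrite /= ct => /set2P[]-> tP; last by rewrite tP in P't.
  by rewrite mulg1 => sE; rewrite sE Ax in A's.
have cHs : H \subset 'C[s].
  rewrite join_subG cAs cycle_subG; apply/cent1P/commute_sym.
  by apply/commgP/conjg_fixP.
have defG : G :=: <[s]> * H.
  have cHS : H \subset 'C(<[s]>) by rewrite cent_cycle.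
  rewrite -cent_joinEr // [LHS](out_gen _ G P sPG outP a t) //.
  by rewrite /= joingA (joingC <[s]>).
apply: (isog_setX_Z2 _ _ _ H _ s) => //.
have := isog_dihedral _ H a t _ t2 A't (inv a Pa) erefl.
by rewrite oa; apply.
Qed.

(** * Classification of groups with zero, one or two long cyclic subgroups *)

Lemma card_long_cyclic0P (gT : finGroupType) (G : {group gT}) :
  #|long_cyclic G| = 0%N <-> exists n : nat, G \isog [set: 'rV['Z_2]_n].
Proof.
have abelV n : 2.-abelem [set: 'rV['Z_2]_n].
  apply/abelemP => //; split; first by apply/centsP => x _ y _; apply: GRing.addrC.
  move=> x _; apply/rowP => i.
  rewrite [LHS](_ : _ = x ord0 i * x ord0 i)%g; last by rewrite mxE.
  by rewrite mxE; case: (x ord0 i) => [[|[|]]] // h; apply: val_inj.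
split=> [/cards0_eq long0|[n isoG]].
  have x2 x : x \in G -> x ^+ 2 = 1.
    move=> Gx; apply/eqP/negPn/negP => x2.
    by have := cycle_long _ G x; rewrite long0 Gx x2 inE.
  (* When all elements square to 1, conjugation by [y] inverts [x], and [x] is its own inverse, so
     the group is commutative. *)
  have abG : 2.-abelem G.
    apply/abelemP => //; split=> //; apply/centsP => x Gx y Gy; apply/commgP.
    apply/conjg_fixP; rewrite (invol_conj _ x y) ?x2 ?groupM //.
    by apply/eqP; rewrite eq_invg_mul; apply/eqP/x2.
  exists (logn 2 #|G|); rewrite (isog_abelem_card _ abG) abelV /= cardsT card_mx mul1n.
  by rewrite card_ord -card_pgroup // abelem_pgroup.
apply/eqP; rewrite cards_eq0; apply/eqP/setP => H; rewrite in_set0; apply/negP.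
case/long_cyclicP => x /andP[Gx] /negP[].
have : 2.-abelem G by rewrite (isog_abelem isoG).
by case/abelemP => // _ ->.
Qed.

(** Treats a long cyclic subgroup containing all the others: it has the same long cyclic subgroups
    as [G], and [n] is its order. *)
Lemma cyclic_or_dihedral_sub (gT : finGroupType) (G A : {group gT}) :
    A \in long_cyclic G ->
    (forall H : {group gT}, H \in long_cyclic G -> H \subset A) ->
  exists n, [/\ 0 < n, count (ltn 2) (divisors n) = #|long_cyclic G|
    & G \isog [set: 'Z_n] \/ G \isog [set: 'D_(2 * n)]].
Proof.
move=> AG subA; have [x /andP[Gx x2] defA] := long_cyclicP AG.
have outA : {in G, forall y, y \notin <[x]> -> y ^+ 2 = 1}.
  by apply: (long_cyclic_out _ <[x]>%G G); rewrite -defA.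
have longA : long_cyclic <[x]> = long_cyclic G.
  by apply: (long_cyclic_sub _ <[x]>%G); rewrite // cycle_subG.
exists #[x]; split=> //; last exact: cyclic_or_dihedral.
by rewrite -longA (card_long_cyclic _ <[x]>%G) ?cycle_cyclic.
Qed.

Lemma card_long_isog_Zp (gT : finGroupType) (G : {group gT}) (n : nat) :
  1 < n -> G \isog [set: 'Z_n] ->
  #|long_cyclic G| = count (ltn 2) (divisors n).
Proof. by move=> n1 /(cyclic_isog_Zp _ _ _ n1)[cG <-]; apply: card_long_cyclic. Qed.

Lemma card_long_isog_dihedral (gT : finGroupType) (G : {group gT}) (n : nat) :
  1 < n -> G \isog [set: 'D_(2 * n)] ->
  #|long_cyclic G| = count (ltn 2) (divisors n).
Proof. by move=> n1 /isog_card_long_cyclic->; apply: card_long_cyclic_dihedral. Qed.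

Lemma card_long_cyclic1P (gT : finGroupType) (G : {group gT}) :
  #|long_cyclic G| = 1%N <->
        [\/ G \isog [set: 'Z_4],
            G \isog 'D_8
          | exists p : nat, [/\ prime p, odd p
              & G \isog [set: 'Z_p] \/ G \isog 'D_(2 * p)]].
Proof.
split=> [/eqP/cards1P[A longG]|].
  have [|H|n [n0 cn isoG]] := cyclic_or_dihedral_sub _ G A.
  - by rewrite longG set11.
  - by rewrite longG => /set1P->.
  move: cn; rewrite longG cards1 => /(count_divisors1P _ n0)[n4 | [pn on]].
    by rewrite n4 in isoG; case: isoG => isoG; [constructor 1|constructor 2].
  by constructor 3; exists n.
case=> [/card_long_isog_Zp->|/(card_long_isog_dihedral _ _ 4)->|[p [pp op]]] //.
have p1 := prime_gt1 pp; case=> [/card_long_isog_Zp|/card_long_isog_dihedral] -> //.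
all: by apply/count_divisors1P; [apply: prime_gt0|right].
Qed.

Lemma card_long_cyclic2P (gT : finGroupType) (G : {group gT}) :
  #|long_cyclic G| = 2%N <->
        [\/ G \isog setX [set: 'Z_2] [set: 'Z_4] \/ G \isog setX [set: 'Z_2] 'D_8,
            G \isog [set: 'Z_8] \/ G \isog 'D_16
          | exists p : nat, [/\ prime p, odd p
              & [\/ G \isog [set: 'Z_(p ^ 2)],
                    G \isog 'D_(2 * p ^ 2),
                    G \isog [set: 'Z_(2 * p)]
                  | G \isog 'D_(4 * p)]]].
Proof.
split=> [/eqP/cards2P[A [B [neqAB longG]]]|].
  (* Nested subgroups give a largest one, handled by the cyclic or dihedral case; incomparable ones
     lead to the products with Z_2. *)
  have [sub|] : (exists2 C : {group gT}, C \in long_cyclic G &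
      forall H : {group gT}, H \in long_cyclic G -> H \subset C) \/
      ~~ (A \subset B) /\ ~~ (B \subset A).
  - case: (boolP (A \subset B)) => sAB; last case: (boolP (B \subset A)) => sBA.
    + left; exists B; first by rewrite longG set22.
      by move=> H; rewrite longG => /set2P[]->.
    + left; exists A; first by rewrite longG set21.
      by move=> H; rewrite longG => /set2P[]->.
    by right.
  - case: sub => C CG subC.
    have [n [n0 cn isoG]] := cyclic_or_dihedral_sub _ G C CG subC.
    move: cn; rewrite longG cards2 neqAB.
    case/(count_divisors2P _ n0) => [n8|[p [pp op nE]]].
      by rewrite n8 in isoG; constructor 2.
    constructor 3; exists p; split=> //; case: nE => nE; rewrite nE in isoG.
      by case: isoG => isoG; [constructor 1|constructor 2].
    by case: isoG => isoG; [constructor 3|constructor 4; rewrite mulnA in isoG].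
  case=> nAB nBA; constructor 1.
  have [a [s [oa s2 A's cas [sPG outP]]]] := two_long_structure _ G A B longG nAB nBA.
  exact: (isog_Z2xZ4_or_Z2xD8 _ G a s).
case.
(* The unique long cyclic subgroup of [K] has order 4 or an odd prime; the latter is impossible
   because its order divides 8. So the count for products with Z_2 applies. *)
- have long2 (rT : finGroupType) (K : {group rT}) :
      #|K| %| 8 -> #|long_cyclic K| = 1%N ->
    G \isog setX [set: 'Z_2] K -> #|long_cyclic G| = 2%N.
    move=> oK long1 /isog_card_long_cyclic->.
    have /eqP/cards1P[A longK] := long1.
    have AK : A \in long_cyclic K by rewrite longK set11.
    have [a /andP[Ka a2] defA] := long_cyclicP AK.
    apply: (long_cyclic_setX _ K a); last by rewrite longK defA.
    have sAK : long_cyclic <[a]> \subset long_cyclic K.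
      apply/subsetP=> H; rewrite !inE => /and3P[sH -> ->].
      by rewrite (subset_trans sH) // cycle_subG.
    have : #|long_cyclic <[a]>| = 1%N.
      apply/eqP; rewrite eqn_leq -{1}long1 subset_leq_card //=.
      by apply/card_gt0P; exists <[a]>%G; rewrite cycle_long cycle_id.
    rewrite (card_long_cyclic _ <[a]>%G) ?cycle_cyclic // -orderE.
    case/(count_divisors1P _ (order_gt0 a)) => // [[pa oa]].
    have : #[a] %| 2 ^ 3 by apply: dvdn_trans oK; apply: order_dvdG.
    by rewrite Euclid_dvdX // dvdn_prime2 //= andbT => /eqP oa2; rewrite oa2 in oa.
  case; apply: long2.
  + by rewrite cardsT card_ord.
  + by rewrite (card_long_isog_Zp _ [set: 'Z_4]%G 4) ?isog_refl.
  + by rewrite (card_dihedral (isT : 1 < 4)) dvdnn.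
  by rewrite (card_long_isog_dihedral _ [set: 'D_8]%G 4) ?isog_refl.
- by case=> [/card_long_isog_Zp|/(card_long_isog_dihedral _ _ 8)] ->.
case=> p [pp op isoG]; have p1 := prime_gt1 pp.
have pp1 : 1 < p ^ 2 by rewrite -mulnn; nia.
have tp1 : 1 < 2 * p by lia.
have cpp : count (ltn 2) (divisors (p ^ 2)) = 2%N.
  by apply/count_divisors2P; [apply: ltnW | right; exists p; split=> //; left].
have ctp : count (ltn 2) (divisors (2 * p)) = 2%N.
  by apply/count_divisors2P; [apply: ltnW | right; exists p; split=> //; right].
case: isoG => isoG.
- by rewrite (card_long_isog_Zp _ _ _ pp1 isoG).
- by rewrite (card_long_isog_dihedral _ _ _ pp1 isoG).
- by rewrite (card_long_isog_Zp _ _ _ tp1 isoG).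
by rewrite (card_long_isog_dihedral _ _ _ tp1) // mulnA.
Qed.

Theorem theorem1p1 (gT : finGroupType) (G : {group gT}) (r : int)
    (hr : ((num_invol G)%:Z = (num_cyclic G)%:Z - r)%R) :
  [/\ r = 0%R <-> (exists n : nat, G \isog [set: 'rV['Z_2]_n]),
      r = 1%R <->
        [\/ G \isog [set: 'Z_4],
            G \isog 'D_8
          | exists p : nat, [/\ prime p, odd p
              & G \isog [set: 'Z_p] \/ G \isog 'D_(2 * p)]]
    & r = 2%R <->
        [\/ G \isog setX [set: 'Z_2] [set: 'Z_4] \/ G \isog setX [set: 'Z_2] 'D_8,
            G \isog [set: 'Z_8] \/ G \isog 'D_16
          | exists p : nat, [/\ prime p, odd p
              & [\/ G \isog [set: 'Z_(p ^ 2)],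
                    G \isog 'D_(2 * p ^ 2),
                    G \isog [set: 'Z_(2 * p)]
                  | G \isog 'D_(4 * p)]]]].
Proof.
have rE : r = Posz #|long_cyclic G| by move: hr; rewrite num_cyclicE; lia.
have rn n : r = Posz n <-> #|long_cyclic G| = n.
  by rewrite rE; split=> [[]|->].
split.
- exact: iff_trans (rn 0%N) (card_long_cyclic0P _ G).
- exact: iff_trans (rn 1%N) (card_long_cyclic1P _ G).
exact: iff_trans (rn 2) (card_long_cyclic2P _ G).
Qed.
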